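(* Let $D\subseteq\mathbb{R}^n$ be nonempty, closed and convex, let $Y\subseteq\mathbb{R}^n$ be an open convex set with $D\subset Y$, and let $G:Y\to\mathbb{R}^n$ satisfy the Lipschitz condition in a neighborhood of each point of $Y$. Suppose that $G$ is strongly monotone on $D$ with constant $\tau>0$, i.e. $\langle G(x)-G(y),x-y\rangle\ge\tau\|x-y\|^2$ for all $x,y\in D$. Consider the variational inequality: find $x^*\in D$ such that $$\langle G(x^* ),x-x^*\rangle\ge0\quad\forall x\in D.$$ Let $\alpha>0$, $\gamma>0$, and $\beta\in(0,1)$ with $\beta<\tau$. Apply Method (GFPMS) (described in the context) with these data, and let $\{x^k\}$ be the points it generates. Then: (i) If the method terminates at some iteration $k$, then $x^k$ is the unique solution of the variational inequality. (ii) If the method does not terminate, the infinite sequence $\{x^k\}$ converges to the unique solution of the variational inequality.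
   Context: Under the assumptions of the claim, the variational inequality has exactly one solution. For fixed $\alpha>0$ the gap function is $$\varphi_\alpha(x)=\max_{y\in D}\{\langle G(x),x-y\rangle-0.5\,\alpha\|x-y\|^2\},$$ whose maximum is attained at the unique point $y_\alpha(x)=\pi_D[x-\alpha^{-1}G(x)]$, where $\pi_D$ is the Euclidean projection onto $D$. The minimal value of $\varphi_\alpha$ on $D$ is $0$. For $\gamma>0$ put $D_\gamma=\{x\in D:\varphi_\alpha(x)\le\gamma\}$. Method (GFPMS), for data $D,G,\gamma,\alpha,\beta$, with $f=\varphi_\alpha$: Step 0. Choose $x^0\in D_\gamma$, $\beta\in(0,1)$, and a sequence $\{\tau_l\}_{l\ge0}$ with $\tau_l\in(0,1)$ and $\tau_l\to0$. Set $k=0$, $l=0$, $u^0=x^0$, and choose $\lambda_0\in(0,\tau_0]$. Step 1. Set $y^k=y_\alpha(x^k)$. If $y^k=x^k$, stop (termination). Otherwise set $d^k=y^k-x^k$ and $z^{k+1}=x^k+\lambda_kd^k$. Step 2. If $f(z^{k+1})\le f(x^k)-\beta\lambda_k\|d^k\|^2$, choose any $\lambda_{k+1}\in[\lambda_k,\tau_l]$ (with $l$ unchanged), set $x^{k+1}=z^{k+1}$ and go to Step 4. Step 3. (Otherwise.) Set $\lambda'_{k+1}=\min\{\lambda_k,\tau_{l+1}\}$, then replace $l$ by $l+1$, and choose any $\lambda_{k+1}\in(0,\lambda'_{k+1}]$. If $f(z^{k+1})\le\gamma$, set $x^{k+1}=z^{k+1}$ and go to Step 4. Otherwise set $x^{k+1}=u^k$,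 $u^{k+1}=u^k$, replace $k$ by $k+1$ and go to Step 1. Step 4. If $f(x^{k+1})<f(u^k)$, set $u^{k+1}=x^{k+1}$; otherwise set $u^{k+1}=u^k$. Replace $k$ by $k+1$ and go to Step 1. Thus $u^k$ is a best point so far: $f(u^k)=\min_{0\le i\le k}f(x^i)$. (The sequence $\{\tau_l\}$ of step-size bounds is unrelated to the strong monotonicity constant $\tau$.) *)

(* Defs.v *)
From HB Require Import structures.
From mathcomp Require Import all_boot all_order all_algebra.
From mathcomp Require Import all_classical all_reals all_analysis.

Set Implicit Arguments.
Unset Strict Implicit.
Unset Printing Implicit Defensive.

Import Order.TTheory GRing.Theory Num.Theory.
Import numFieldNormedType.Exports.

Local Open Scope classical_set_scope.
Local Open Scope ring_scope.

Section Euclidean.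
Context {R : realType} {n : nat}.
Implicit Types (u v x y p : 'rV[R]_n) (D Y : set 'rV[R]_n).

Definition dot u v : R := \sum_(i < n) u 0 i * v 0 i.

(* The library norm on 'rV[R]_n is the sup norm; its topology, which is the
   one used for [open], [closed], [nbhs] and limits, is the Euclidean one. *)
Definition enorm u : R := Num.sqrt (dot u u).

(* A map G on Y is represented by a total function whose values outside of Y
   are unconstrained; hence the condition [U `<=` Y], harmless for Y open. *)
Definition locally_lipschitz Y (G : 'rV[R]_n -> 'rV[R]_n) : Prop :=
  forall x, Y x -> exists U : set 'rV[R]_n, exists L : R,
    [/\ nbhs x U, U `<=` Y &
        forall y z, U y -> U z -> enorm (G y - G z) <= L * enorm (y - z)].

Definition strongly_monotone D (G : 'rV[R]_n -> 'rV[R]_n) (tau : R) : Prop :=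
  forall x y, D x -> D y -> tau * enorm (x - y) ^+ 2 <= dot (G x - G y) (x - y).

Definition vi_solutions D (G : 'rV[R]_n -> 'rV[R]_n) : set 'rV[R]_n :=
  [set xs | D xs /\ forall x, D x -> 0 <= dot (G xs) (x - xs)].

(* For D nonempty, closed and convex the nearest point exists and is unique;
   otherwise the value is an arbitrary nearest point, or x if there is none. *)
Definition proj D x : 'rV[R]_n :=
  xget x [set p | D p /\ forall y, D y -> enorm (x - p) <= enorm (x - y)].

(* For alpha > 0 and D nonempty, closed and convex the supremum is a maximum,
   attained exactly at [gap_point D G alpha x]. *)
Definition gap D (G : 'rV[R]_n -> 'rV[R]_n) (alpha : R) x : R :=
  sup [set dot (G x) (x - y) - 2^-1 * alpha * enorm (x - y) ^+ 2 | y in D].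

Definition gap_point D (G : 'rV[R]_n -> 'rV[R]_n) (alpha : R) x : 'rV[R]_n :=
  proj D (x - alpha^-1 *: G x).

Definition gap_level D (G : 'rV[R]_n -> 'rV[R]_n) (alpha gamma : R) :
    set 'rV[R]_n :=
  [set x | D x /\ gap D G alpha x <= gamma].

End Euclidean.

(* The data (x^k, u^k, lambda_k, l) at the beginning of iteration k. *)
Record gfpms_state (R : realType) (n : nat) := GfpmsState {
  iterate : 'rV[R]_n;
  best_iterate : 'rV[R]_n;
  stepsize : R;
  stage : nat }.

Section GFPMS.
Context {R : realType} {n : nat}.
Variables (D : set 'rV[R]_n) (G : 'rV[R]_n -> 'rV[R]_n).
Variables (gamma alpha beta : R) (taus : nat -> R).

Local Notation f := (gap D G alpha).

Definition gfpms_dir (x : 'rV[R]_n) : 'rV[R]_n := gap_point D G alpha x - x.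

Definition gfpms_trial (x : 'rV[R]_n) (lam : R) : 'rV[R]_n :=
  x + lam *: gfpms_dir x.

Definition gfpms_better (x u : 'rV[R]_n) : 'rV[R]_n :=
  if f x < f u then x else u.

Definition gfpms_init (s : gfpms_state R n) : Prop :=
  [/\ gap_level D G alpha gamma (iterate s),
      best_iterate s = iterate s,
      0 < stepsize s <= taus 0 &
      stage s = 0%N].

Definition gfpms_stop (s : gfpms_state R n) : Prop :=
  gap_point D G alpha (iterate s) = iterate s.

Definition sufficient_decrease (x : 'rV[R]_n) (lam : R) : bool :=
  f (gfpms_trial x lam) <= f x - beta * lam * enorm (gfpms_dir x) ^+ 2.

(* One iteration from a state where the method does not stop. The method is
   nondeterministic: the next step size lam' is any element of an interval. *)
Inductive gfpms_step : gfpms_state R n -> gfpms_state R n -> Prop :=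
| GfpmsDescent x u lam l (lam' : R) of
    gap_point D G alpha x <> x &
    sufficient_decrease x lam &
    lam <= lam' <= taus l :
    gfpms_step (GfpmsState x u lam l)
      (GfpmsState (gfpms_trial x lam) (gfpms_better (gfpms_trial x lam) u)
         lam' l)
| GfpmsAccept x u lam l (lam' : R) of
    gap_point D G alpha x <> x &
    ~~ sufficient_decrease x lam &
    0 < lam' <= Num.min lam (taus l.+1) &
    f (gfpms_trial x lam) <= gamma :
    gfpms_step (GfpmsState x u lam l)
      (GfpmsState (gfpms_trial x lam) (gfpms_better (gfpms_trial x lam) u)
         lam' l.+1)
| GfpmsRestart x u lam l (lam' : R) of
    gap_point D G alpha x <> x &
    ~~ sufficient_decrease x lam &
    0 < lam' <= Num.min lam (taus l.+1) &
    gamma < f (gfpms_trial x lam) :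
    gfpms_step (GfpmsState x u lam l) (GfpmsState u u lam' l.+1).

End GFPMS.

(* Main.v *)
Require Import Defs.
From HB Require Import structures.
From mathcomp Require Import all_boot all_order all_algebra.
From mathcomp Require Import all_classical all_reals all_analysis.
From mathcomp Require Import ring lra.

Set Implicit Arguments.
Unset Strict Implicit.
Unset Printing Implicit Defensive.

Import Order.TTheory GRing.Theory Num.Theory.
Import numFieldNormedType.Exports.

Local Open Scope classical_set_scope.
Local Open Scope ring_scope.

(** Write f for the gap function and d(x) for the search direction, the
gap-maximizing point minus x. As G is only locally Lipschitz, f may fail
to be differentiable, so its decrease is estimated by comparing suprema. Three
facts carry the proof.

Descent. Let z = x + lam d(x), and compare f(z), attained at the gap point of
z, with the value at x of the same competitor. The first-order terms are
controlled by the optimality condition of the projection and by strong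
monotonicity along d(x); the error terms are of second order in lam, because
the gap point is a Lipschitz function of x wherever G is. This gives
f(z) <= f(x) - (tau - C lam) lam |d(x)|^2 with C depending only on tau, alpha
and a local Lipschitz constant ([gap_trial_decrease]). As beta < tau, near each point of D
every small step passes the descent test, and on a compact subset of D a single
step bound serves all points ([uniform_sufficient_decrease]).

Boundedness. Strong monotonicity makes f grow quadratically on D, so the level
set, which contains all the iterates, is bounded ([gap_level_bounded]).

Stationarity. A point of D where d vanishes solves the variational inequality,
and there is at most one solution ([gap_stationary], [vi_solution_unique]).

Every failure of the test raises the stage l, which caps the step sizes by
taus l; infinitely many failures would make them tend to 0, against the uniform
step bound. So there are only finitely many failures ([eventually_descends]).
After the last one the step sizes do not decrease, so the decrease of f along the iterates dominates a constant
times |d(x^k)|^2; as f is nonnegative, d(x^k) tends to 0 ([dir_cvg0]). The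
iterates cannot eventually leave a compact set that contains them all, so d has
a zero there: this proves existence. They do eventually leave each compact set
on which d has no zero ([eventually_notin_compact]); applied outside a
neighbourhood of the solution, this is convergence. *)

(** * Euclidean inner product and norm *)

Section euclidean.
Context {R : realType} {n : nat}.
Implicit Types u v w : 'rV[R]_n.

Lemma dotC u v : dot u v = dot v u.
Proof. by apply: eq_bigr => i _; rewrite mulrC. Qed.

Lemma dotDl u v w : dot (u + v) w = dot u w + dot v w.
Proof. by rewrite -big_split; apply: eq_bigr => i _; rewrite mxE mulrDl. Qed.

Lemma dotZl a u v : dot (a *: u) v = a * dot u v.
Proof. by rewrite mulr_sumr; apply: eq_bigr => i _; rewrite mxE mulrA. Qed.

Lemma dotNl u v : dot (- u) v = - dot u v.
Proof. by rewrite -scaleN1r dotZl mulN1r. Qed.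

Lemma dotDr u v w : dot u (v + w) = dot u v + dot u w.
Proof. by rewrite dotC dotDl !(dotC u). Qed.

Lemma dotZr a u v : dot u (a *: v) = a * dot u v.
Proof. by rewrite dotC dotZl dotC. Qed.

Lemma dotNr u v : dot u (- v) = - dot u v.
Proof. by rewrite dotC dotNl dotC. Qed.

Definition dotE := (dotDl, dotDr, dotNl, dotNr, dotZl, dotZr).

Lemma dot_ge0 u : 0 <= dot u u.
Proof. by apply: sumr_ge0 => i _; rewrite -expr2 sqr_ge0. Qed.

Lemma enorm_ge0 u : 0 <= enorm u.
Proof. exact: sqrtr_ge0. Qed.

Lemma enorm_sqr u : enorm u ^+ 2 = dot u u.
Proof. by rewrite sqr_sqrtr // dot_ge0. Qed.

Lemma enormN u : enorm (- u) = enorm u.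
Proof. by rewrite /enorm dotNl dotNr opprK. Qed.

Lemma enormB u v : enorm (u - v) = enorm (v - u).
Proof. by rewrite -enormN opprB. Qed.

Lemma enormZ a u : enorm (a *: u) = `|a| * enorm u.
Proof.
by rewrite /enorm dotZl dotZr mulrA -expr2 sqrtrM ?sqr_ge0 // sqrtr_sqr.
Qed.

Lemma coord_le_enorm u i : `|u 0 i| <= enorm u.
Proof.
rewrite -sqrtr_sqr ler_wsqrtr // /dot (bigD1 i) //= -expr2 lerDl.
by apply: sumr_ge0 => j _; rewrite -expr2 sqr_ge0.
Qed.

Lemma enorm_eq0 u : enorm u = 0 -> u = 0.
Proof.
move=> u0; apply/rowP => i; rewrite mxE; apply/eqP.
by rewrite -normr_le0 -u0 coord_le_enorm.
Qed.

Lemma norm_le_enorm u : `|u| <= enorm u.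
Proof.
rewrite [leLHS]mx_normrE; apply/bigmax_leP; split; first exact: enorm_ge0.
by move=> [i j] _ /=; rewrite ord1 coord_le_enorm.
Qed.

Lemma enorm_le_norm u : enorm u <= Num.sqrt n%:R * `|u|.
Proof.
rewrite -[X in _ * X]ger0_norm // -sqrtr_sqr -sqrtrM ?ler0n // ler_wsqrtr //.
rewrite /dot -[X in X%:R * _]card_ord -sum1_card natr_sum mulr_suml.
apply: ler_sum => i _; rewrite mul1r -expr2 -[X in X <= _]ger0_norm ?sqr_ge0 //.
rewrite normrX lerXn2r ?nnegrE //.
rewrite [leRHS]mx_normrE; apply/bigmax_geP; right => /=.
by exists (0, i).
Qed.

(** Cauchy-Schwarz, from the nonnegativity of the square of |v| u - |u| v. *)
Lemma dot_le_enorm u v : dot u v <= enorm u * enorm v.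
Proof.
have [v0|v0] := eqVneq (enorm v) 0.
  rewrite (enorm_eq0 v0) -(scale0r (0 : 'rV[R]_n)) dotZr mul0r.
  by rewrite mulr_ge0 ?enorm_ge0.
have vgt0 : 0 < enorm v by rewrite lt0r v0 enorm_ge0.
have [u0|u0] := eqVneq (enorm u) 0.
  rewrite (enorm_eq0 u0) -(scale0r (0 : 'rV[R]_n)) dotZl mul0r.
  by rewrite mulr_ge0 ?enorm_ge0.
have ugt0 : 0 < enorm u by rewrite lt0r u0 enorm_ge0.
have := dot_ge0 (enorm v *: u - enorm u *: v).
rewrite !dotE -!enorm_sqr (dotC v u) => h.
have : 0 <= 2 * (enorm u * enorm v) * (enorm u * enorm v - dot u v) by lra.
by rewrite pmulr_rge0 ?subr_ge0 // !mulr_gt0.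
Qed.

Lemma enormD u v : enorm (u + v) <= enorm u + enorm v.
Proof.
rewrite -ler_sqr ?nnegrE ?addr_ge0 ?enorm_ge0 //.
rewrite sqrrD !enorm_sqr !dotE (dotC v u).
by have := dot_le_enorm u v; lra.
Qed.

(** The topology is that of the sup norm, while all estimates are Euclidean:
continuity statements go through this comparison of the two norms. *)
Lemma enorm_lipschitz_continuous (V : normedModType R) (F : 'rV[R]_n -> V) C x :
  (\forall y \near x, `|F x - F y| <= C * enorm (x - y)) ->
  {for x, continuous F}.
Proof.
move=> FC; apply/(@cvgrPdist_le R V _ (nbhs x)) => e e0.
pose c := `|C| * Num.sqrt n%:R + 1.
have c0 : 0 < c by rewrite ltr_wpDl // mulr_ge0 // sqrtr_ge0.
near=> y.
apply: (le_trans (near FC y _)) => //.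
apply: (@le_trans _ _ (c * `|x - y|)).
  apply: (@le_trans _ _ (`|C| * (Num.sqrt n%:R * `|x - y|))).
    apply: (@le_trans _ _ (`|C| * enorm (x - y))).
      by rewrite ler_wpM2r ?enorm_ge0 ?ler_norm.
    by rewrite ler_wpM2l // enorm_le_norm.
  by rewrite mulrA ler_wpM2r // lerDl.
rewrite mulrC -ler_pdivlMr //.
near: y; apply: cvgr_dist_le; [exact: cvg_id|exact: divr_gt0].
Unshelve. all: by end_near. Qed.

Lemma enorm_dist u v : `|enorm u - enorm v| <= enorm (u - v).
Proof.
have := enormD (u - v) v; have := enormD (v - u) u.
rewrite !subrK (enormB v u) => h1 h2.
by rewrite ler_distl; apply/andP; split; lra.
Qed.

Lemma continuous_enorm_dist c : continuous (fun x : 'rV[R]_n => enorm (x - c)).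
Proof.
move=> u; apply: (@enorm_lipschitz_continuous _ _ 1); near=> v.
by rewrite mul1r (le_trans (enorm_dist _ _)) // opprB addrA subrK.
Unshelve. all: by end_near. Qed.

Lemma compact_closed_enorm_ball (D : set 'rV[R]_n) c r :
  closed D -> compact (D `&` [set x | enorm (x - c) <= r]).
Proof.
move=> D_closed; apply: bounded_closed_compact.
  exists (r + `|c|); split; first exact: num_real.
  move=> M rM x [_ /= xr]; rewrite (le_trans _ (ltW rM)) //.
  rewrite -[X in `|X|](subrK c) (le_trans (ler_normD _ _)) // lerD2r.
  exact: le_trans (norm_le_enorm _) xr.
apply: closedI => //.
rewrite (_ : mkset _ = (fun x => enorm (x - c)) @^-1` [set t | t <= r]) //.
apply: closed_comp; last exact: closed_le.
by move=> x _; exact: continuous_enorm_dist.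
Qed.

End euclidean.

(** * Projection onto a closed convex set *)

(* [proj] alone denotes the projection of a product space onto a factor. *)
Local Notation proj := Defs.proj.

Section projection.
Context {R : realType} {n : nat} (D : set 'rV[R]_n).
Hypotheses (D_neq0 : D !=set0) (D_closed : closed D).
Hypothesis D_convex : convex_set (D : set (convex_lmodType 'rV[R]_n)).
Implicit Types x y w : 'rV[R]_n.

Lemma convex_segment x y t :
  D x -> D y -> 0 <= t -> t <= 1 -> D (x + t *: (y - x)).
Proof.
move=> Dx Dy t0 t1.
have /set_mem := D_convex (Itv01 t0 t1) (mem_set Dy) (mem_set Dx).
rewrite /conv /= scalerBl scale1r => Dt; congr D : Dt.
by rewrite scalerBr addrC addrAC addrA.
Qed.

(** Only points not farther from x than a given point of D compete, and they
form a compact set. *)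
Lemma proj_nearest x :
  D (proj D x) /\ forall y, D y -> enorm (x - proj D x) <= enorm (x - y).
Proof.
have [x0 Dx0] := D_neq0.
pose B := D `&` [set y | enorm (y - x) <= enorm (x0 - x)].
have B0 : B !=set0 by exists x0; split => /=.
have cB : compact B by exact: compact_closed_enorm_ball.
have [|p /set_mem [Dp px] p_min] := EVT_min_rV B0 cB (f := fun y => enorm (y - x)).
  by apply: continuous_subspaceT; exact: continuous_enorm_dist.
rewrite /proj; case: xgetP => [q _ //|/(_ p)]; case; split=> // y Dy.
rewrite enormB (enormB x y).
have [yx|/ltW yx] := leP (enorm (y - x)) (enorm (x0 - x)).
  by apply: p_min; apply: mem_set; split.
exact: le_trans px yx.
Qed.

Lemma proj_in x : D (proj D x). Proof. by case: (proj_nearest x). Qed.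

(** Moving from p = proj D x towards w by a fraction t stays in D and changes the
squared distance to x by - 2 t <x - p, w - p> + t^2 |w - p|^2, which would be
negative for small t if the inner product were positive. *)
Lemma proj_obtuse x w : D w -> dot (x - proj D x) (w - proj D x) <= 0.
Proof.
move=> Dw; set p := proj D x; set v := w - p.
have [Dp p_min] := proj_nearest x.
rewrite leNgt; apply/negP => vpos.
have vv_ge0 := dot_ge0 v.
(* This t lies in ]0, 1] and satisfies t |v|^2 < 2 <x - p, v>. *)
pose t := dot (x - p) v / (dot (x - p) v + dot v v).
have den : 0 < dot (x - p) v + dot v v by rewrite ltr_wpDr.
have t0 : 0 < t by rewrite divr_gt0.
have t1 : t <= 1 by rewrite ler_pdivrMr // mul1r lerDl.
have tE : t * (dot (x - p) v + dot v v) = dot (x - p) v.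
  by rewrite mulfVK // gt_eqF.
have := p_min _ (convex_segment Dp Dw (ltW t0) t1).
rewrite -/p -/v opprD addrA.
rewrite -ler_sqr ?nnegrE ?enorm_ge0 // !enorm_sqr.
move: (x - p) v vpos vv_ge0 @t den t0 t1 tE => r v rv vv t den t0 t1 tE.
rewrite !dotE (dotC v r).
have : 0 < t * (2 * dot r v - t * dot v v).
  by rewrite mulr_gt0 //; nra.
nra.
Qed.

(** Adding the obtuse-angle inequalities of x and y, each tested at the projection
of the other, gives |p - q|^2 <= <x - y, p - q>. *)
Lemma proj_nonexpansive x y : enorm (proj D x - proj D y) <= enorm (x - y).
Proof.
set p := proj D x; set q := proj D y.
have := proj_obtuse x (proj_in y); have := proj_obtuse y (proj_in x).
rewrite -/p -/q => hq hp.
have : enorm (p - q) ^+ 2 <= enorm (x - y) * enorm (p - q).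
  apply: le_trans (dot_le_enorm _ _); rewrite enorm_sqr.
  have -> : x - y = (x - p) - (y - q) + (p - q).
    by rewrite opprB; apply/rowP => i; rewrite !mxE; ring.
  have e : q - p = - (p - q) by rewrite opprB.
  move: hp hq; rewrite e dotNr; move: (x - p) (y - q) (p - q) => a b c ac bc.
  by rewrite dotDl dotDl dotNl; lra.
have [->|pq0] := eqVneq (enorm (p - q)) 0; first by rewrite enorm_ge0.
by rewrite expr2 ler_pM2r // lt0r pq0 enorm_ge0.
Qed.

End projection.

(** * The gap function *)

Section gap_function.
Context {R : realType} {n : nat} (D : set 'rV[R]_n) (G : 'rV[R]_n -> 'rV[R]_n).
Context (alpha : R).
Hypotheses (D_neq0 : D !=set0) (D_closed : closed D).
Hypothesis D_convex : convex_set (D : set (convex_lmodType 'rV[R]_n)).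
Hypothesis alpha_gt0 : 0 < alpha.
Implicit Types x y w : 'rV[R]_n.

Local Notation f := (gap D G alpha).
Local Notation dir := (gfpms_dir D G alpha).

Definition gap_objective x y : R :=
  dot (G x) (x - y) - 2^-1 * alpha * enorm (x - y) ^+ 2.

Lemma gap_point_in x : D (gap_point D G alpha x).
Proof. exact: proj_in. Qed.

(** The obtuse-angle property of the projection of x - G x / alpha, multiplied by
- alpha: the first-order condition for maximality of the gap objective at the
gap point. *)
Lemma gap_point_optimal x w :
  D w -> 0 <= dot (G x + alpha *: dir x) (w - gap_point D G alpha x).
Proof.
move=> Dw; have := proj_obtuse D_neq0 D_closed D_convex (x - alpha^-1 *: G x) Dw.
rewrite -/(gap_point _ _ _ _) /gfpms_dir; set y := gap_point _ _ _ _.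
have -> : G x + alpha *: (y - x) = - (alpha *: (x - alpha^-1 *: G x - y)).
  apply/rowP => i; rewrite !mxE; field; exact: lt0r_neq0.
by rewrite dotNl dotZl oppr_ge0 pmulr_rle0.
Qed.

(** The objective is quadratic in y with Hessian - alpha, so it falls below its
value at the gap point by the nonnegative first-order term plus
alpha / 2 |w - y|^2. *)
Lemma gap_objective_max x w :
  D w -> gap_objective x w <= gap_objective x (gap_point D G alpha x).
Proof.
move=> /(gap_point_optimal x); rewrite /gap_objective /gfpms_dir.
set y := gap_point _ _ _ _ => opt.
have := dot_ge0 (w - y).
have -> : x - w = (x - y) - (w - y) by rewrite opprB addrA subrK.
move: opt; have -> : y - x = - (x - y) by rewrite opprB.
move: (x - y) (w - y) => a b; rewrite !enorm_sqr !dotE (dotC b a) => opt bb.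
have : 0 <= alpha * dot b b by rewrite mulr_ge0 // ltW.
lra.
Qed.

Lemma has_sup_gap_objective x : has_sup [set gap_objective x y | y in D].
Proof.
split; first by case: D_neq0 => y Dy; exists (gap_objective x y), y.
exists (gap_objective x (gap_point D G alpha x)) => _ [y Dy <-].
exact: gap_objective_max.
Qed.

Lemma gap_ge x y : D y -> gap_objective x y <= f x.
Proof. by move=> Dy; apply: ub_le_sup; [case: (has_sup_gap_objective x)|exists y]. Qed.

Lemma gapE x : f x = gap_objective x (gap_point D G alpha x).
Proof.
apply/eqP; rewrite eq_le gap_ge ?andbT; last exact: gap_point_in.
apply: ge_sup; first by case: (has_sup_gap_objective x).
by move=> _ [y Dy <-]; exact: gap_objective_max.
Qed.

(** The competitor y = x. *)
Lemma gap_ge0 x : D x -> 0 <= f x.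
Proof.
move=> Dx; apply: le_trans (gap_ge x Dx); rewrite /gap_objective subrr.
by rewrite -(scale0r (0 : 'rV[R]_n)) enormZ dotZr normr0 !mul0r expr0n mulr0 subrr.
Qed.

Lemma gap_stationary x :
  D x -> gap_point D G alpha x = x -> vi_solutions D G x.
Proof.
move=> Dx yx; split=> // w /(gap_point_optimal x).
by rewrite /gfpms_dir yx subrr scaler0 addr0.
Qed.

Lemma gfpms_dir_eq0 x : enorm (dir x) = 0 -> gap_point D G alpha x = x.
Proof. by move/enorm_eq0/eqP; rewrite subr_eq0 => /eqP. Qed.

Lemma gap_point_lipschitz x z L : enorm (G x - G z) <= L * enorm (x - z) ->
  enorm (gap_point D G alpha x - gap_point D G alpha z) <=
  (1 + L / alpha) * enorm (x - z).
Proof.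
move=> GL; apply: le_trans (proj_nonexpansive _ _ _ _ _) _ => //.
have -> : x - alpha^-1 *: G x - (z - alpha^-1 *: G z) =
    (x - z) + (- alpha^-1) *: (G x - G z).
  by apply/rowP => i; rewrite !mxE; ring.
apply: le_trans (enormD _ _) _; rewrite mulrDl mul1r lerD2l enormZ.
rewrite normrN gtr0_norm ?invr_gt0 // mulrC -ler_pdivlMr ?invr_gt0 // invrK.
by rewrite mulrAC divfK // lt0r_neq0.
Qed.

End gap_function.

(** * Descent and coercivity under strong monotonicity *)

Section objective_decrease.
Context {R : realType} {n : nat}.

(** The computation behind the descent estimate, with h, h' the values of G at x, z
and y, y' their gap points; M is a Lipschitz constant for gap points. Put
d = y - x, e = y - y', g = h' - h. The difference of the two objectives is
lam (<h, d> + alpha |d|^2) - (1 - lam) <g, d> + <g, e> - alpha lam <d, e>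
minus alpha lam^2 / 2 |d|^2. The first term is nonpositive by optimality of y,
the second is at most - (1 - lam) lam tau |d|^2 by monotonicity, and the next
two are O(lam^2 |d|^2). *)
Lemma objective_trial_decrease (h h' x y z y' : 'rV[R]_n) (alpha tau lam L M : R) :
  z = x + lam *: (y - x) ->
  0 < alpha -> 0 < lam -> lam <= 1 -> 0 <= L -> 0 <= M ->
  enorm (h - h') <= L * enorm (x - z) ->
  enorm (y - y') <= M * enorm (x - z) ->
  0 <= dot (h + alpha *: (y - x)) (x - y) ->
  tau * enorm (z - x) ^+ 2 <= dot (h' - h) (z - x) ->
  dot h' (z - y') - 2^-1 * alpha * enorm (z - y') ^+ 2 <=
  dot h (x - y') - 2^-1 * alpha * enorm (x - y') ^+ 2 -
    (tau - lam * (tau + (L + alpha) * M)) * lam * enorm (y - x) ^+ 2.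
Proof.
move=> zE alpha0 lam0 lam1 L0 M0.
have zx : z - x = lam *: (y - x) by rewrite zE addrC addKr.
rewrite (enormB x z) zx (enormB h h') enormZ (gtr0_norm lam0).
rewrite -(opprB y x).
have -> : x - y' = - (y - x) + (y - y') by rewrite opprB addrA subrK.
have -> : z - y' = lam *: (y - x) - (y - x) + (y - y').
  by rewrite -zx; apply/rowP => i; rewrite !mxE; ring.
have -> : dot h' = dot (h + (h' - h)) by congr dot; rewrite addrC subrK.
move: (y - x) (y - y') (h' - h) => d e g {zx zE x y z y' h'}.
move=> GL eM opt mono.
have ge := dot_le_enorm g e; have de := dot_le_enorm d (- e).
have ge' : enorm g * enorm e <= L * M * lam ^+ 2 * enorm d ^+ 2.
  have := ler_pM (enorm_ge0 _) (enorm_ge0 _) GL eM; lra.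
have de' : enorm d * enorm e <= M * lam * enorm d ^+ 2.
  have := ler_wpM2l (enorm_ge0 d) eM; lra.
have {}mono : tau * lam * enorm d ^+ 2 <= dot g d.
  by rewrite -(ler_pM2l lam0); move: mono; rewrite dotZr exprMn; lra.
have {}mono : 0 <= (1 - lam) * (dot g d - tau * lam * enorm d ^+ 2).
  by rewrite mulr_ge0 ?subr_ge0.
have {}opt : 0 <= lam * (- (dot h d + alpha * enorm d ^+ 2)).
  by rewrite mulr_ge0 ?(ltW lam0) //; move: opt; rewrite !dotE -enorm_sqr; lra.
have {}de : alpha * lam * (- dot d e) <= alpha * lam * (M * lam * enorm d ^+ 2).
  apply: ler_wpM2l; first by rewrite mulr_ge0 // ltW.
  by apply: le_trans de'; move: de; rewrite enormN dotNr.
have sq : 0 <= alpha * lam ^+ 2 * enorm d ^+ 2.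
  by rewrite mulr_ge0 ?sqr_ge0 // mulr_ge0 ?sqr_ge0 // ltW.
move: ge; rewrite !enorm_sqr !dotE (dotC e d) -!enorm_sqr => ge.
lra.
Qed.

End objective_decrease.

Section strongly_monotone_gap.
Context {R : realType} {n : nat} (D Y : set 'rV[R]_n) (G : 'rV[R]_n -> 'rV[R]_n).
Context (tau alpha : R).
Hypotheses (D_neq0 : D !=set0) (D_closed : closed D).
Hypothesis D_convex : convex_set (D : set (convex_lmodType 'rV[R]_n)).
Hypotheses (sub_DY : D `<=` Y) (G_lip : locally_lipschitz Y G).
Hypotheses (tau_gt0 : 0 < tau) (G_mono : strongly_monotone D G tau).
Hypothesis alpha_gt0 : 0 < alpha.
Implicit Types x y z : 'rV[R]_n.

Local Notation f := (gap D G alpha).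
Local Notation gp := (gap_point D G alpha).
Local Notation dir := (gfpms_dir D G alpha).
Local Notation trial := (gfpms_trial D G alpha).

Lemma vi_solution_unique x y : vi_solutions D G x -> vi_solutions D G y -> x = y.
Proof.
move=> [Dx xP] [Dy yP]; have := xP _ Dy; have := yP _ Dx; have := G_mono Dx Dy.
have -> : y - x = - (x - y) by rewrite opprB.
rewrite dotNr dotDl dotNl => m py px.
have : tau * enorm (x - y) ^+ 2 <= 0 by lra.
rewrite pmulr_rle0 // => h; apply/eqP; rewrite -subr_eq0; apply/eqP.
by apply: enorm_eq0; apply/eqP; rewrite -sqrf_eq0 eq_le h sqr_ge0.
Qed.

Lemma vi_solutions_set1 x : vi_solutions D G x -> vi_solutions D G = [set x].
Proof.
move=> sx; apply/seteqP; split=> y; first by move=> sy; exact: vi_solution_unique.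
by move->.
Qed.

Lemma trial_in x lam : D x -> 0 <= lam -> lam <= 1 -> D (trial x lam).
Proof. by move=> Dx; apply: convex_segment => //; exact: gap_point_in. Qed.

(** Testing the gap at x + t (x0 - x), with t so small that t alpha <= tau, gives
f(x) >= t (tau / 2 r^2 - |G x0| r) where r = |x - x0|. *)
Lemma gap_level_bounded gamma x0 : D x0 ->
  exists r, forall x, gap_level D G alpha gamma x -> enorm (x - x0) <= r.
Proof.
move=> Dx0; pose t := Num.min 1 (tau / alpha); pose g := enorm (G x0).
have t0 : 0 < t by rewrite lt_min ltr01 divr_gt0.
have t1 : t <= 1 by rewrite ge_min lexx.
have tta : t * alpha <= tau by rewrite -ler_pdivlMr // ge_min lexx orbT.
have g0 : 0 <= g by exact: enorm_ge0.
exists (1 + 2 * (g + `|gamma| / t) / tau) => x [Dx fx].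
have := gap_ge G D_neq0 D_closed D_convex alpha_gt0 x
  (convex_segment D_convex Dx Dx0 (ltW t0) t1).
have := G_mono Dx Dx0.
rewrite /gap_objective opprD addrA subrr add0r -scalerN opprB enormZ (gtr0_norm t0).
move=> mono fge; have := dot_le_enorm (- G x0) (x - x0).
rewrite enormN -/g dotNl => gCS.
move: mono fge; rewrite dotDl dotNl dotZr; set r := enorm (x - x0) in gCS *.
have r0 : 0 <= r by exact: enorm_ge0.
move: (dot (G x) _) (dot (G x0) _) gCS => a b gCS mono fge.
have gt0 : 0 <= `|gamma| / t by rewrite divr_ge0 // ltW.
have key : t * (tau / 2 * r ^+ 2 - g * r) <= `|gamma|.
  have h1 : t * (t * alpha * r ^+ 2) <= t * (tau * r ^+ 2).
    by rewrite ler_wpM2l ?ler_wpM2r ?sqr_ge0 // ltW.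
  have h2 : t * (tau * r ^+ 2 - g * r) <= t * a.
    by rewrite ler_wpM2l // ?(ltW t0) //; lra.
  have := ler_norm gamma; lra.
rewrite mulrC -ler_pdivlMr // in key.
have [r1|r1] := leP r 1.
  by rewrite (le_trans r1) // lerDl divr_ge0 ?(ltW tau_gt0) // mulr_ge0 // addr_ge0.
set q := `|gamma| / t in key gt0 *.
have h : r * (tau / 2 * r - g - q) <= 0.
  have : q * 1 <= q * r by rewrite ler_wpM2l // ltW.
  lra.
rewrite pmulr_rle0 ?(lt_trans ltr01) // in h.
apply: (@le_trans _ _ (2 * (g + q) / tau)); last by rewrite lerDr.
by rewrite ler_pdivlMr //; lra.
Qed.

(** The gap point of the trial point is only a competitor in the supremum that
defines f(x), but this bounds f(x) from below, the direction that is needed. *)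
Lemma gap_trial_decrease x lam L : D x -> 0 < lam -> lam <= 1 -> 0 <= L ->
  enorm (G x - G (trial x lam)) <= L * enorm (x - trial x lam) ->
  f (trial x lam) <=
  f x - (tau - lam * (tau + (L + alpha) * (1 + L / alpha))) * lam * enorm (dir x) ^+ 2.
Proof.
move=> Dx lam0 lam1 L0 GL.
have Dz : D (trial x lam) by apply: trial_in => //; exact: ltW.
rewrite (gapE G D_neq0 D_closed D_convex alpha_gt0 (trial x lam)).
have := gap_ge G D_neq0 D_closed D_convex alpha_gt0 x
  (gap_point_in G alpha D_neq0 D_closed (trial x lam)).
rewrite -(lerD2r (- ((tau - lam * (tau + (L + alpha) * (1 + L / alpha))) * lam *
  enorm (dir x) ^+ 2))).
apply: le_trans; apply: objective_trial_decrease => //.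
- by rewrite addr_ge0 // divr_ge0 // ltW.
- exact: gap_point_lipschitz.
- exact: gap_point_optimal.
- exact: G_mono.
Qed.

Lemma gfpms_dir_continuous x : D x ->
  {for x, continuous (dir : 'rV[R]_n -> 'rV[R]_n)}.
Proof.
move=> /sub_DY /G_lip [U [L [xU _ GL]]].
apply: (@enorm_lipschitz_continuous _ _ _ _ (1 + L / alpha + 1)); near=> y.
apply: le_trans (norm_le_enorm _) _.
have -> : dir x - dir y = (gp x - gp y) + (y - x).
  by rewrite /gfpms_dir opprB (addrC y) addrACA (addrC (- x)).
apply: le_trans (enormD _ _) _.
rewrite mulrDl mul1r (enormB y x) lerD2r.
apply: gap_point_lipschitz => //; apply: GL; first exact: nbhs_singleton.
exact: (near xU y).
Unshelve. all: by end_near. Qed.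

Lemma enorm_dir_continuous x : D x -> {for x, continuous (fun y => enorm (dir y))}.
Proof.
move=> Dx; apply: (@continuous_comp _ _ _ dir (@enorm R n)).
  exact: gfpms_dir_continuous.
have := @continuous_enorm_dist R n 0 (dir x).
by under [X in continuous_at _ X]funext => y do rewrite subr0.
Qed.

(** A neighbourhood of x on which G is Lipschitz contains x' and its trial points for
x' close to x and lam small, by continuity of the search direction; then the
descent estimate applies with one Lipschitz constant, and its coefficient
tau - C lam exceeds beta for small lam. *)
Lemma near_sufficient_decrease beta x : beta < tau -> D x ->
  \forall x' \near x & lam \near 0^'+,
    D x' -> sufficient_decrease D G alpha beta x' lam.
Proof.
move=> beta_tau Dx; have [U [L [xU _ GL]]] := G_lip (sub_DY Dx).
pose C := tau + (`|L| + alpha) * (1 + `|L| / alpha).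
have C0 : 0 < C.
  by rewrite addr_gt0 // mulr_gt0 //; [rewrite ltr_wpDl|rewrite ltr_pwDl // divr_ge0 // ltW].
have trialU : \forall x' \near x & lam \near 0^'+, U (trial x' lam).
  have : (fun p : 'rV[R]_n * R => trial p.1 p.2) @ filter_prod (nbhs x) 0^'+
      --> x + (0 : R) *: dir x.
    apply: cvgD; first exact: cvg_fst.
    apply: cvgZ; first by apply: cvg_trans cvg_snd _; exact: cvg_within.
    apply: (@cvg_comp _ _ _ fst dir _ (nbhs x)); first exact: cvg_fst.
    exact: gfpms_dir_continuous.
  by rewrite scale0r addr0; apply.
have [[/= V W] [xV W0] VWU] := trialU.
near=> x' lam => Dx'.
have lam0 : 0 < lam by near: lam; exact: nbhs_right_gt.
have lam1 : lam <= 1 by near: lam; exact: nbhs_right_le.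
have lamC : lam * C <= tau - beta.
  rewrite -ler_pdivlMr //; near: lam; apply: nbhs_right_le.
  by rewrite divr_gt0 // subr_gt0.
have GL' : enorm (G x' - G (trial x' lam)) <= `|L| * enorm (x' - trial x' lam).
  apply: (@le_trans _ _ (L * enorm (x' - trial x' lam))).
    apply: GL; first exact: (near xU x').
    by apply: (VWU (x', lam)); split; [exact: (near xV x')|exact: (near W0 lam)].
  by rewrite ler_wpM2r ?enorm_ge0 ?ler_norm.
rewrite /sufficient_decrease.
apply: le_trans (gap_trial_decrease Dx' lam0 lam1 (normr_ge0 L) GL') _.
rewrite lerD2l lerN2 ler_wpM2r ?sqr_ge0 // ler_wpM2r ?(ltW lam0) //.
by rewrite -/C; lra.
Unshelve. all: by end_near. Qed.

Lemma uniform_sufficient_decrease beta (B : set 'rV[R]_n) :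
  beta < tau -> compact B -> B `<=` D ->
  exists2 lbar : R, 0 < lbar & forall x lam, B x -> 0 < lam < lbar ->
    sufficient_decrease D G alpha beta x lam.
Proof.
move=> beta_tau /compact_near_coveringP cB BD.
have := cB _ 0^'+ (fun lam x => D x -> sufficient_decrease D G alpha beta x lam)
  _ (fun x Bx => near_sufficient_decrease beta_tau (BD x Bx)).
move=> /(_ _) [e /= e0 eP]; exists e => // x lam Bx /andP[lam0 lame].
apply: (eP lam) => //=; last exact: BD.
by rewrite sub0r normrN gtr0_norm.
Qed.

End strongly_monotone_gap.

(** Near a point x of K the values of psi exceed |psi x| / 2 in absolute value,
whereas the values of psi along u are eventually smaller: hence u k avoids a
neighbourhood of x for large k. Compactness of K makes this uniform. *)
Lemma eventually_notin_compact (R : realType) (T : topologicalType) (K : set T)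
    (psi : T -> R) (u : nat -> T) :
  compact K -> (forall x, K x -> {for x, continuous psi}) ->
  (forall x, K x -> psi x != 0) -> psi \o u @ \oo --> (0 : R) ->
  \forall k \near \oo, ~ K (u k).
Proof.
move=> /compact_near_coveringP cK psi_cont psi_neq0 psi_u.
have : \forall k \near \oo, K `<=` (fun x => u k <> x).
  apply: cK => x Kx.
  have e0 : 0 < `|psi x| / 2 by rewrite divr_gt0 // normr_gt0 psi_neq0.
  near=> x' k => ukx'.
  have h1 : `|psi x - psi x'| < `|psi x| / 2.
    by near: x'; exact: (@cvgr_dist_lt _ _ _ _ _ psi (psi x) (psi_cont _ Kx)).
  have h2 : `|0 - psi (u k)| < `|psi x| / 2.
    by near: k; exact: (@cvgr_dist_lt _ _ _ _ _ (psi \o u) 0 psi_u).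
  have := ler_normD (psi x - psi x') (psi x').
  rewrite subrK; rewrite sub0r normrN ukx' in h2; lra.
by apply: filterS => k Kk Ku; exact: (Kk _ Ku).
Unshelve. all: by end_near. Qed.

(** * The iterates of the method *)

Section method.
Context {R : realType} {n : nat} (D Y : set 'rV[R]_n) (G : 'rV[R]_n -> 'rV[R]_n).
Context (tau gamma alpha beta : R) (taus : nat -> R).
Hypotheses (D_neq0 : D !=set0) (D_closed : closed D).
Hypothesis D_convex : convex_set (D : set (convex_lmodType 'rV[R]_n)).
Hypotheses (sub_DY : D `<=` Y) (G_lip : locally_lipschitz Y G).
Hypotheses (tau_gt0 : 0 < tau) (G_mono : strongly_monotone D G tau).
Hypotheses (alpha_gt0 : 0 < alpha) (beta_gt0 : 0 < beta) (beta_tau : beta < tau).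
Hypotheses (taus_itv : forall l, 0 < taus l < 1).

Local Notation f := (gap D G alpha).
Local Notation dir := (gfpms_dir D G alpha).
Local Notation level := (gap_level D G alpha gamma).
Local Notation step := (gfpms_step D G gamma alpha beta taus).
Local Notation descends t :=
  (sufficient_decrease D G alpha beta (iterate t) (stepsize t)).

Definition feasible_state (t : gfpms_state R n) : Prop :=
  [/\ level (iterate t), level (best_iterate t)
    & 0 < stepsize t <= taus (stage t)].

(** A descent step does not increase f, an accepted step is tested against gamma and a
restart returns to the best point, so the level set is never left. *)
Lemma feasible_step t t' : feasible_state t -> step t t' -> feasible_state t'.
Proof.
have better x u : level x -> level u -> level (gfpms_better D G alpha x u).
  by rewrite /gfpms_better; case: ifP.
move=> feas t_t'; case: t_t' feas => [x u lam l lam' _ dec lamP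
  |x u lam l lam' _ _ lamP fz|x u lam l lam' _ _ lamP _];
  case=> /= -[Dx fx] lu /andP[lam0 lam_taus];
  have lam1 : lam <= 1 by (apply: le_trans lam_taus (ltW _); case/andP: (taus_itv l)).
- have lz : level (gfpms_trial D G alpha x lam).
    split; first by apply: trial_in => //; exact: ltW.
    apply: le_trans dec (le_trans _ fx); rewrite gerDl oppr_le0.
    by rewrite mulr_ge0 ?sqr_ge0 // mulr_ge0 // ltW.
  split=> //=; first exact: better.
  by case/andP: lamP => lam_lam' ->; rewrite (lt_le_trans lam0).
- have lz : level (gfpms_trial D G alpha x lam).
    by split=> //; apply: trial_in => //; exact: ltW.
  split=> //=; first exact: better.
  by move: lamP; rewrite le_min => /and3P[-> _ ->].
- by split=> //=; move: lamP; rewrite le_min => /and3P[-> _ ->].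
Qed.

Lemma step_descends t t' : step t t' -> descends t ->
  [/\ iterate t' = gfpms_trial D G alpha (iterate t) (stepsize t),
      stepsize t <= stepsize t' & stage t' = stage t].
Proof.
case=> [x u lam l lam' _ _ /andP[]|x u lam l lam' _ /negbTE dec _ _
  |x u lam l lam' _ /negbTE dec _ _] //=; by rewrite dec.
Qed.

Lemma step_fails t t' : step t t' -> ~~ descends t -> stage t' = (stage t).+1.
Proof. by case=> [x u lam l lam' _ dec _|//|//] /=; rewrite dec. Qed.

(** At a stage l with taus l below the uniform step bound every step passes the
descent test, so the stage cannot grow any more. The stage is therefore bounded,
and once its maximal value is attained no test can fail. *)
Lemma eventually_descends (s : nat -> gfpms_state R n) (B : set 'rV[R]_n) :
  taus @ \oo --> (0 : R) -> compact B -> B `<=` D ->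
  (forall k, B (iterate (s k))) -> (forall k, feasible_state (s k)) ->
  (forall k, step (s k) (s k.+1)) ->
  exists K, forall k, (K <= k)%N -> descends (s k).
Proof.
move=> taus_cvg cB BD sB sfeas sstep.
have [lbar lbar0 lbarP] := uniform_sufficient_decrease D_neq0 D_closed D_convex
  sub_DY G_lip tau_gt0 G_mono alpha_gt0 beta_tau cB BD.
have [l0 _ l0P] : \forall l \near \oo, taus l < lbar.
  exact: (cvgr_lt _ taus_cvg).
have descends_late k : (l0 <= stage (s k))%N -> descends (s k).
  move=> lk; have [_ _ /andP[lam0 lam_taus]] := sfeas k.
  by apply: lbarP => //; rewrite lam0 (le_lt_trans lam_taus) // l0P.
have stage_step k : stage (s k.+1) = (stage (s k) + ~~ descends (s k))%N.
  have [d|d] := boolP (descends (s k)).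
    by have [_ _ ->] := step_descends (sstep k) d; rewrite addn0.
  by rewrite (step_fails (sstep k) d) addn1.
pose m0 := (stage (s 0%N) + l0)%N.
have stage_le k : (stage (s k) <= m0)%N.
  elim: k => [|k IH]; first exact: leq_addr.
  rewrite stage_step; case: (boolP (descends (s k))) => [_|nd]; first by rewrite addn0.
  rewrite addn1; apply: leq_trans (leq_addl _ _); rewrite ltnNge.
  by apply: contra nd => /descends_late.
pose attained m := `[< exists k, stage (s k) = m >].
have attained0 : exists m, attained m.
  by exists (stage (s 0%N)); apply/asboolP; exists 0%N.
have attained_le m : attained m -> (m <= m0)%N by move=> /asboolP [k <-].
have [m /asboolP [K Km] m_max] := ex_maxnP attained0 attained_le.
exists K.
suff stage_const j : stage (s (K + j)%N) = m /\ descends (s (K + j)%N).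
  by move=> k Kk; rewrite -(subnKC Kk); case: (stage_const (k - K)%N).
have desc_max k : stage (s k) = m -> descends (s k).
  move=> km; apply/negPn/negP => nd.
  have := m_max (stage (s k.+1)); rewrite stage_step nd km addn1 ltnn.
  move=> h; have : false; last by []; apply: h; apply/asboolP.
  by exists k.+1; rewrite stage_step nd km addn1.
elim: j => [|j [IH1 IH2]]; first by rewrite addn0; split=> //; exact: desc_max.
have e : stage (s (K + j.+1)%N) = m by rewrite addnS stage_step IH2 addn0.
by split=> //; exact: desc_max.
Qed.

(** From iteration K on, f decreases by at least beta lambda_K |d(x^k)|^2 while
staying nonnegative, so its increments tend to 0. *)
Lemma dir_cvg0 (s : nat -> gfpms_state R n) K :
  (forall k, feasible_state (s k)) -> (forall k, step (s k) (s k.+1)) ->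
  (forall k, (K <= k)%N -> descends (s k)) ->
  (fun k => enorm (dir (iterate (s k)))) @ \oo --> (0 : R).
Proof.
move=> sfeas sstep desc.
rewrite -(cvg_shiftn K).
pose a k := f (iterate (s (k + K)%N)).
pose lam := stepsize (s K).
have lam0 : 0 < lam by case: (sfeas K) => _ _ /andP[].
have lam_le k : lam <= stepsize (s (k + K)%N).
  elim: k => [|k IH]; first by rewrite add0n.
  apply: le_trans IH _.
  by have [_ ? _] := step_descends (sstep _) (desc _ (leq_addl k K)).
have a_dec k : beta * lam * enorm (dir (iterate (s (k + K)%N))) ^+ 2 <= a k - a k.+1.
  have dk := desc _ (leq_addl k K); have [it _ _] := step_descends (sstep _) dk.
  rewrite lerBrDr -lerBrDl /a addSn it.
  apply: le_trans dk _; rewrite lerD2l lerN2 ler_wpM2r ?sqr_ge0 //.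
  by rewrite ler_wpM2l // ltW.
have bl0 : 0 < beta * lam by rewrite mulr_gt0.
have a_cvg : cvgn a.
  apply: nonincreasing_is_cvgn.
    apply/nonincreasing_seqP => k; rewrite -subr_ge0 (le_trans _ (a_dec k)) //.
    by rewrite mulr_ge0 ?sqr_ge0 // ltW.
  exists 0 => _ [k _ <-].
  by apply: (gap_ge0 G D_neq0 D_closed D_convex alpha_gt0); case: (sfeas (k + K)%N) => -[].
have diff_cvg : (fun k => a k - a k.+1) @ \oo --> (0 : R).
  rewrite -[X in _ --> X](subrr (limn a)); apply: cvgB => //.
  by rewrite (cvg_shiftS a).
apply/cvgrPdist_lt => e e0; near=> k.
rewrite sub0r normrN ger0_norm ?enorm_ge0 //.
rewrite -ltr_sqr ?nnegrE ?enorm_ge0 ?(ltW e0) // -(ltr_pM2l bl0).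
apply: le_lt_trans (a_dec k) (le_lt_trans (ler_norm _) _).
rewrite -normrN -sub0r; near: k.
by apply: (@cvgr_dist_lt _ _ _ _ _ _ 0 diff_cvg); rewrite mulr_gt0 // exprn_gt0.
Unshelve. all: by end_near. Qed.

End method.

Theorem theorem3 (R : realType) (n : nat) (D Y : set 'rV[R]_n)
  (G : 'rV[R]_n -> 'rV[R]_n) (tau gamma alpha beta : R) (taus : nat -> R)
  (s : nat -> gfpms_state R n)
  (D_neq0 : D !=set0) (D_closed : closed D)
  (D_convex : convex_set (D : set (convex_lmodType 'rV[R]_n)))
  (Y_open : open Y)
  (Y_convex : convex_set (Y : set (convex_lmodType 'rV[R]_n)))
  (sub_DY : D `<=` Y)
  (G_lip : locally_lipschitz Y G)
  (tau_gt0 : 0 < tau) (G_mono : strongly_monotone D G tau)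
  (alpha_gt0 : 0 < alpha) (gamma_gt0 : 0 < gamma)
  (beta_gt0 : 0 < beta) (beta_lt1 : beta < 1) (beta_lt_tau : beta < tau)
  (taus_itv : forall l, 0 < taus l < 1) (taus_cvg : taus @ \oo --> (0 : R))
  (s_init : gfpms_init D G gamma alpha taus (s 0%N)) :
  (forall k : nat,
      (forall j, (j < k)%N ->
        gfpms_step D G gamma alpha beta taus (s j) (s j.+1)) ->
      gfpms_stop D G alpha (s k) ->
    vi_solutions D G = [set iterate (s k)]) /\
  ((forall k : nat, gfpms_step D G gamma alpha beta taus (s k) (s k.+1)) ->
    exists xs : 'rV[R]_n, vi_solutions D G = [set xs] /\
      (fun k => iterate (s k)) @ \oo --> xs).
Proof.
have feas k : (forall j, (j < k)%N ->
    gfpms_step D G gamma alpha beta taus (s j) (s j.+1)) ->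
    feasible_state D G gamma alpha taus (s k).
  elim: k => [|k IH] steps.
    by have [lx ux lam l] := s_init; split; rewrite ?ux ?l.
  have sk : feasible_state D G gamma alpha taus (s k).
    by apply: IH => j jk; apply: steps; exact: ltnW.
  exact: (feasible_step D_neq0 D_closed D_convex beta_gt0 taus_itv sk (steps k _)).
have zero_solution x : D x -> enorm (gfpms_dir D G alpha x) = 0 ->
    vi_solutions D G = [set x].
  move=> Dx /gfpms_dir_eq0 dx0; apply: (vi_solutions_set1 tau_gt0 G_mono).
  exact: (gap_stationary (alpha := alpha)).
split=> [k steps stop|steps].
  have [[Dx _] _ _] := feas k steps.
  apply: (vi_solutions_set1 tau_gt0 G_mono).
  exact: (gap_stationary (alpha := alpha)).
have {}feas k : feasible_state D G gamma alpha taus (s k) by exact: feas.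
have [[Dx0 _] _ _] := feas 0%N.
have [r rP] := gap_level_bounded D_neq0 D_closed D_convex tau_gt0 G_mono alpha_gt0
  gamma Dx0.
pose B := D `&` [set x | enorm (x - iterate (s 0%N)) <= r].
have cB : compact B by exact: compact_closed_enorm_ball.
have sB k : B (iterate (s k)) by have [lx _ _] := feas k; split; [case: lx|exact: rP].
have BD : B `<=` D by move=> x [].
have [K desc] := eventually_descends D_neq0 D_closed D_convex sub_DY G_lip tau_gt0
  G_mono alpha_gt0 beta_lt_tau taus_cvg cB BD sB feas steps.
have dir0 := dir_cvg0 D_neq0 D_closed D_convex alpha_gt0 beta_gt0 feas steps desc.
have dir_cont C : C `<=` B -> forall x, C x ->
    {for x, continuous (fun y => enorm (gfpms_dir D G alpha y))}.
  move=> CB x /CB/BD Dx.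
  exact: (enorm_dir_continuous D_neq0 D_closed D_convex sub_DY G_lip alpha_gt0 Dx).
(* Otherwise the iterates, all in B, would eventually lie outside of B. *)
have [xs [Bxs xs0]] : exists x, B x /\ enorm (gfpms_dir D G alpha x) = 0.
  apply/not_existsP => no_zero.
  have := eventually_notin_compact cB (dir_cont B (@subset_refl _ _)) _ dir0.
  case; first by move=> x Bx; apply/eqP => x0; exact: (no_zero x).
  by move=> N _ /(_ N (leqnn N)); exact.
have solE := zero_solution _ (BD _ Bxs) xs0.
exists xs; split=> // U; rewrite nbhsE => -[V [V_open Vxs] VU].
have cBV : compact (B `\` V) by apply: compact_closedI => //; exact: open_closedC.
have := eventually_notin_compact cBV (dir_cont _ (@subIsetl _ _ _)) _ dir0.
move=> /(_ _)[|N _ NP].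
  move=> x [Bx nVx]; apply/eqP => x0; apply: nVx.
  have : vi_solutions D G x by rewrite (zero_solution _ (BD _ Bx) x0).
  by rewrite solE => ->.
exists N => // k /NP nk; apply: VU; apply: contrapT => nV; exact: nk.
Qed.
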